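(* Let $T_n(x)=\frac{a_0}{2}+\sum_{k=1}^n\left[a_k\cos(kx)+b_k\sin(kx)\right]$ be a real trigonometric polynomial with $a_n^2+b_n^2>0$, whose pairwise distinct roots in the half-open interval $[-\pi,\pi)$ are $x_1,\dots,x_m$, of multiplicities $\alpha_1,\dots,\alpha_m$ respectively, with $\alpha_1+\dots+\alpha_m=2n$. Let $d=\min_{i\neq j}|x_i-x_j|$, and let $c,q,\xi$ be positive numbers such that $q<1$, $2c<\xi$, $d-2c>0$, and $\max_{i\neq j}|x_i-x_j|<2\pi-2\xi$. Put $A=\min\{|\sin(\xi/2)|,\ |\sin(d/2-c)|\}$ and suppose that $c$ is small enough so that, for every $i=1,\dots,m$, $$c^2\left\{\alpha_i^2+\frac{1}{4A^2}(2n-\alpha_i)^2+\frac c4\,\frac{\alpha_i}{A}(2n-\alpha_i)+\alpha_i\left[\frac{1}{2A^2}(2n-\alpha_i)+\frac16\,\frac cA(2n-\alpha_i)\right]\right\}<\left[\alpha_i\left(1-\frac{c^2}{8}\right)-\frac c2\,\frac1A(2n-\alpha_i)\right]^2.$$ Let the initial approximations $x_i^{[0]}$ satisfy $|x_i^{[0]}-x_i|\le cq$ for $i=1,\dots,m$, and let $x_i^{[k]}$ be defined by the iteration $$x_i^{[k+1]}=x_i^{[k]}-\alpha_i\frac{T_n(x_i^{[k]})}{T_n'(x_i^{[k]})}\left[1+\frac{T_n(x_i^{[k]})}{T_n'(x_i^{[k]})}\cdot\frac{(Q_i^{[k]})'(x_i^{[k]})}{Q_i^{[k]}(x_i^{[k]})}\right],\quad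 i=1,\dots,m,\ k=0,1,\dots,$$ where $Q_i^{[k]}(x)=\prod_{j=1,\,j\neq i}^m\sin^{\alpha_j}\left[(x-x_j^{[k]})/2\right]$. Then for every integer $k\ge 0$, $$|x_i^{[k]}-x_i|\le c\,q^{3^k},\qquad i=1,\dots,m.$$
   Context: All numbers are real. The multiplicities $\alpha_i$ are positive integers known in advance. Primes denote derivatives with respect to $x$; in $(Q_i^{[k]})'$ the points $x_j^{[k]}$ are held fixed. The exponent $3^k$ in $q^{3^k}$ is the $k$-th power of $3$. *)

(* Defs.v *)
From HB Require Import structures.
From mathcomp Require Import all_boot all_order all_algebra.
From mathcomp Require Import all_classical all_reals all_analysis.

Set Implicit Arguments.
Unset Strict Implicit.
Unset Printing Implicit Defensive.

Import Order.TTheory GRing.Theory Num.Theory.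
Import numFieldNormedType.Exports.

Local Open Scope classical_set_scope.
Local Open Scope ring_scope.

Definition trig_poly (R : realType) (n : nat) (a b : nat -> R) (x : R) : R :=
  a 0%N / 2 + \sum_(1 <= k < n.+1) (a k * cos (k%:R * x) + b k * sin (k%:R * x)).

Definition root_of_mult (R : realType) (f : R -> R) (x : R) (k : nat) : Prop :=
  (forall j, (j < k)%N -> f^`(j)%classic x = 0) /\ f^`(k)%classic x <> 0.

Definition root_dists (R : realType) (m : nat) (x : 'I_m -> R) : set R :=
  [set r | exists i j : 'I_m, i != j /\ r = `|x i - x j|].

Definition is_min (R : realType) (S : set R) (r : R) : Prop :=
  S r /\ forall s, S s -> r <= s.

Definition is_max (R : realType) (S : set R) (r : R) : Prop :=
  S r /\ forall s, S s -> s <= r.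

Definition Qfun (R : realType) (m : nat) (alpha : 'I_m -> nat)
    (y : 'I_m -> R) (i : 'I_m) (x : R) : R :=
  \prod_(j < m | j != i) sin ((x - y j) / 2) ^+ alpha j.

(* Division is total with 0 / 0 = 0: when y i is exactly a multiple root of T,
   T and T^`() both vanish there and the step leaves y i unchanged. *)
Definition iter_step (R : realType) (m : nat) (alpha : 'I_m -> nat)
    (T : R -> R) (y : 'I_m -> R) (i : 'I_m) : R :=
  let u := T (y i) / T^`()%classic (y i) in
  let Q := Qfun alpha y i in
  y i - (alpha i)%:R * u * (1 + u * (Q^`()%classic (y i) / Q (y i))).

(* Main.v *)
Require Import Defs.
From HB Require Import structures.
From mathcomp Require Import all_boot all_order all_algebra.
From mathcomp Require Import all_classical all_reals all_analysis.
From mathcomp Require Import ring lra.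

Set Implicit Arguments.
Unset Strict Implicit.
Unset Printing Implicit Defensive.

Import Order.TTheory GRing.Theory Num.Theory.
Import numFieldNormedType.Exports.

Local Open Scope classical_set_scope.
Local Open Scope ring_scope.

(** The iteration is a Newton-like step for a function whose logarithmic
    derivative is known.  A trigonometric polynomial of degree n whose roots
    have total multiplicity 2n is a constant multiple of
    [\prod_j sin ((t - x j) / 2) ^+ alpha j] ([trig_poly_factor]).  Hence, with
    [eps = y i - x i], [S = sin (eps / 2)], [C = cos (eps / 2)] and [al] the
    multiplicity of [x i],
      [T' / T = (al * (C / S) + B) / 2]
    where [B] is the sum of the [alpha j * cot ((y i - x j) / 2)], j <> i, while
    [Q' / Q = Bt / 2], where [Bt] has [y j] in place of [x j].  Substituting,
    the new error is a fraction with denominator [(al * C + B * S) ^+ 2] whose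
    numerator is a sum of four terms, each at least cubic in the errors: two have
    the factor [C * eps - 2 * S], of third order in [eps], one has the factor
    [(B - Bt) * S ^+ 2], where [B - Bt] is of first order in the errors of the
    other roots, and one has the factor [eps * S ^+ 2].  This is where the order
    three of the method comes from.

    The separation hypotheses keep every [sin ((y i - x j) / 2)] and
    [sin ((y i - y j) / 2)] at least [A] in absolute value, since the sine is
    unimodal on [0, pi] ([norm_sin_half_ge]).  The smallness condition on [c]
    then makes the error fraction at most [e ^+ 3 / c ^+ 2] as soon as all
    current errors are at most [e <= c] ([cubic_error_bound],
    [iter_step_error]).  With [e = c * q ^+ (3 ^ k)] this bound is
    [c * q ^+ (3 ^ k.+1)], and the theorem follows by induction on [k].

    The factorization is obtained without complex numbers: T is a form of degree
    2n in [cos (t / 2)] and [sin (t / 2)], the space of such forms is invariant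
    under translation of t, and a form of degree N + 1 vanishing at x0 is
    [sin ((t - x0) / 2)] times a form of degree N. *)

(** * Forms in the cosine and sine of the half angle *)

(** The functions that are homogeneous polynomials of degree N in [cos (t / 2)]
    and [sin (t / 2)].  The recursion on the degree makes every closure property
    below a direct induction, with no bookkeeping of coefficients. *)
Fixpoint half_form (R : realType) (N : nat) (f : R -> R) : Prop :=
  if N is N'.+1 then
    exists g h, [/\ half_form N' g, half_form N' h &
      forall t, f t = cos (t / 2) * g t + sin (t / 2) * h t]
  else exists k, forall t, f t = k.

Lemma half_form_lin (R : realType) (N : nat) (f g : R -> R) (k l : R) :
  half_form N f -> half_form N g ->
  half_form N (fun t => k * f t + l * g t).
Proof.
elim: N f g => [|N IH] f g /=.
  by move=> [u hu] [v hv]; exists (k * u + l * v) => t; rewrite hu hv.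
move=> [f1 [f2 [h1 h2 hf]]] [g1 [g2 [h3 h4 hg]]].
exists (fun t => k * f1 t + l * g1 t), (fun t => k * f2 t + l * g2 t).
split; [exact: IH | exact: IH |] => t.
by rewrite hf hg; ring.
Qed.

Lemma half_form_eq (R : realType) (N : nat) (f g : R -> R) :
  (forall t, f t = g t) -> half_form N f -> half_form N g.
Proof. by move=> /funext ->. Qed.

(** The phases [k] and [l] are free because translating t acts linearly on the
    pair [(cos (t / 2), sin (t / 2))]. *)
Lemma half_formS (R : realType) (N : nat) (k l : R) (g h : R -> R) :
  half_form N g -> half_form N h ->
  half_form N.+1 (fun t => cos ((t - k) / 2) * g t + sin ((t - l) / 2) * h t).
Proof.
move=> hg hh.
exists (fun t => cos (k / 2) * g t + (- sin (l / 2)) * h t),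
       (fun t => sin (k / 2) * g t + cos (l / 2) * h t).
split; [exact: half_form_lin | exact: half_form_lin |] => t.
by rewrite !mulrBl cosB sinB; ring.
Qed.

Lemma half_form_mul_sin (R : realType) (N : nat) (x0 : R) (g : R -> R) :
  half_form N g -> half_form N.+1 (fun t => sin ((t - x0) / 2) * g t).
Proof.
move=> hg.
have h0 : half_form N (fun t => 0 * g t + 0 * g t) by exact: half_form_lin.
apply: half_form_eq (half_formS 0 x0 h0 hg) => t.
by rewrite !mul0r addr0 mulr0 add0r.
Qed.

Lemma half_form_mul_cos (R : realType) (N : nat) (x0 : R) (g : R -> R) :
  half_form N g -> half_form N.+1 (fun t => cos ((t - x0) / 2) * g t).
Proof.
move=> hg.
have h0 : half_form N (fun t => 0 * g t + 0 * g t) by exact: half_form_lin.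
apply: half_form_eq (half_formS x0 0 hg h0) => t.
by rewrite !mul0r addr0 mulr0 addr0.
Qed.

(** Multiplication by [cos (t / 2) ^+ 2 + sin (t / 2) ^+ 2 = 1]. *)
Lemma half_form_add2 (R : realType) (N : nat) (f : R -> R) :
  half_form N f -> half_form N.+2 f.
Proof.
move=> hf.
apply: half_form_eq (half_formS 0 0 (half_form_mul_cos 0 hf)
  (half_form_mul_sin 0 hf)) => t.
by rewrite !mulrA -mulrDl -!expr2 cos2Dsin2 mul1r.
Qed.

Lemma half_form_double (R : realType) (k n : nat) (f : R -> R) :
  (k <= n)%N -> half_form k.*2 f -> half_form n.*2 f.
Proof.
move=> /subnK <-; elim: (n - k)%N => [|j IH] // hf.
by rewrite addSn doubleS; apply/half_form_add2/IH.
Qed.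

Lemma half_form_cos_sin (R : realType) (k : nat) :
  half_form k.*2 (fun t : R => cos (k%:R * t)) /\
  half_form k.*2 (fun t : R => sin (k%:R * t)).
Proof.
elim: k => [|k [hc hs]].
  by split; [exists 1 | exists 0] => t; rewrite mul0r ?cos0 ?sin0.
have cosE (t : R) : cos t = cos (t / 2) ^+ 2 - sin (t / 2) ^+ 2.
  by rewrite {1}[t]splitr cosD -!expr2.
have sinE (t : R) : sin t = 2 * (sin (t / 2) * cos (t / 2)).
  by rewrite {1}[t]splitr sinD; ring.
have mulSr (t : R) : k.+1%:R * t = k%:R * t + t by rewrite -natr1 mulrDl mul1r.
have CC f := @half_form_mul_cos R k.*2 0 f.
have SS f := @half_form_mul_sin R k.*2 0 f.
rewrite doubleS; split.
  apply: half_form_eq (half_formS 0 0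
    (half_form_lin 1 (-1) (CC _ hc) (SS _ hs))
    (half_form_lin (-1) (-1) (SS _ hc) (CC _ hs))) => t /=.
  by rewrite subr0 mulSr cosD (cosE t) (sinE t); ring.
apply: half_form_eq (half_formS 0 0
  (half_form_lin 1 1 (CC _ hs) (SS _ hc))
  (half_form_lin (-1) 1 (SS _ hs) (CC _ hc))) => t /=.
by rewrite subr0 mulSr sinD (cosE t) (sinE t); ring.
Qed.

Lemma half_form_trig_poly (R : realType) (n : nat) (a b : nat -> R) :
  half_form n.*2 (trig_poly n a b).
Proof.
pose p N t := a 0%N / 2 +
  \sum_(1 <= k < N.+1) (a k * cos (k%:R * t) + b k * sin (k%:R * t)).
rewrite -[trig_poly n a b]/(p n).
elim: n => [|n IH].
  by exists (a 0%N / 2) => t; rewrite /p big_geq // addr0.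
have [hc hs] := half_form_cos_sin R n.+1.
have hn := half_form_double (leqnSn n) IH.
apply: half_form_eq (half_form_lin 1 1 hn
  (half_form_lin (a n.+1) (b n.+1) hc hs)) => t.
by rewrite !mul1r /p [in RHS]big_nat_recr //= -addrA.
Qed.

(** Modulo [sin ((t - x0) / 2)] a form is a multiple of the power of
    [cos ((t - x0) / 2)], as one sees after recentering the form at x0. *)
Lemma half_form_split (R : realType) (N : nat) (x0 : R) (f : R -> R) :
  half_form N.+1 f -> exists k g, half_form N g /\
    forall t, f t = k * cos ((t - x0) / 2) ^+ N.+1 + sin ((t - x0) / 2) * g t.
Proof.
have recenter M (h : R -> R) : half_form M.+1 h ->
    exists u v, [/\ half_form M u, half_form M v & forall t,
      h t = cos ((t - x0) / 2) * u t + sin ((t - x0) / 2) * v t].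
  move=> [u [v [hu hv hh]]].
  exists (fun t => cos (x0 / 2) * u t + sin (x0 / 2) * v t),
         (fun t => (- sin (x0 / 2)) * u t + cos (x0 / 2) * v t).
  split; [exact: half_form_lin | exact: half_form_lin |] => t.
  have -> : h t = cos ((t - x0) / 2 + x0 / 2) * u t
                + sin ((t - x0) / 2 + x0 / 2) * v t.
    by rewrite hh -mulrDl subrK.
  by rewrite cosD sinD; ring.
elim: N f => [|N IH] f /recenter[u [v [hu hv hf]]].
  have [k hk] := hu; exists k, v; split=> // t.
  by rewrite hf hk expr1; ring.
have [k [g [hg huE]]] := IH _ hu.
exists k, (fun t => 1 * (cos ((t - x0) / 2) * g t) + 1 * v t); split.
  exact: (half_form_lin 1 1 (half_form_mul_cos x0 hg) hv).
by move=> t; rewrite hf huE [_ ^+ N.+2]exprS; ring.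
Qed.

Lemma half_form_div (R : realType) (N : nat) (x0 : R) (f : R -> R) :
  half_form N.+1 f -> f x0 = 0 ->
  exists g, half_form N g /\ forall t, f t = sin ((t - x0) / 2) * g t.
Proof.
move=> /(half_form_split x0)[k [g [hg fE]]] f0.
have k0 : k = 0.
  by move: f0; rewrite fE subrr mul0r cos0 sin0 expr1n mulr1 mul0r addr0.
by exists g; split=> // t; rewrite fE k0 mul0r add0r.
Qed.

(** * Derivatives and multiplicities *)

Lemma is_derive_half (R : realType) (f : R -> R) (f' x0 t : R) :
  is_derive ((t - x0) / 2) 1 f f' ->
  is_derive t 1 (fun t : R => f ((t - x0) / 2)) (f' / 2).
Proof.
move=> hf.
have h1 : is_derive t 1 (fun u : R => (u - x0) / 2) (1 / 2).
  have -> : (fun u : R => (u - x0) / 2) = 2^-1 *: (id - cst x0).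
    by apply/funext => u /=; rewrite /GRing.scale /= mulrC.
  by apply: is_derive_eq; rewrite subr0 /GRing.scale /= mulrC.
have h2 := @is_derive1_comp _ f (fun u : R => (u - x0) / 2) t _ _ hf h1.
by apply: is_derive_eq h2 _; rewrite mul1r.
Qed.

Lemma is_derive_half_sin (R : realType) (x0 t : R) :
  is_derive t 1 (fun t : R => sin ((t - x0) / 2)) (cos ((t - x0) / 2) / 2).
Proof. exact: is_derive_half. Qed.

Lemma is_derive_half_cos (R : realType) (x0 t : R) :
  is_derive t 1 (fun t : R => cos ((t - x0) / 2)) (- sin ((t - x0) / 2) / 2).
Proof. exact: is_derive_half. Qed.

(** Forms are closed under differentiation, so they serve as the class of smooth
    functions in which derivatives can be iterated. *)
Lemma half_form_derive (R : realType) (N : nat) (f : R -> R) :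
  half_form N f -> exists f', half_form N f' /\
    forall t : R, is_derive t 1 f (f' t).
Proof.
elim: N f => [|N IH] f.
  move=> [k /funext ->]; exists (fun=> 0); split; first by exists 0.
  by move=> t; exact: is_derive_cst.
move=> [g [h [hg hh fE]]].
have [g' [hg' dg]] := IH _ hg; have [h' [hh' dh]] := IH _ hh.
exists (fun t => cos ((t - 0) / 2) * (1 * g' t + 2^-1 * h t) +
                 sin ((t - 0) / 2) * (1 * h' t + (- 2^-1) * g t)); split.
  by apply: half_formS; exact: half_form_lin.
move=> t.
have -> : f = (fun t => cos ((t - 0) / 2)) * g + (fun t => sin ((t - 0) / 2)) * h.
  by apply/funext => u; rewrite fE !fctE subr0.
have dc := is_derive_half_cos 0 t; have ds := is_derive_half_sin 0 t.
apply: is_derive_eq (is_deriveD (is_deriveM dc (dg t)) (is_deriveM ds (dh t))) _.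
by rewrite /GRing.scale /=; field.
Qed.

(** The k-th derivative of [sin ((t - x0) / 2) ^+ k * g t] at x0 is a nonzero
    multiple of [g x0].  This is how the analytic multiplicity of a root is
    turned into divisibility.  Differentiating lowers k by one and replaces g by
    the form G of the proof, whose value at x0 is a nonzero multiple of [g x0]. *)
Lemma cofactor_vanishes (R : realType) (k N : nat) (x0 : R) (f g : R -> R) :
  half_form N g -> (forall t, f t = sin ((t - x0) / 2) ^+ k * g t) ->
  f^`(k)%classic x0 = 0 -> g x0 = 0.
Proof.
elim: k N f g => [|k IH] N f g hg fE.
  by rewrite derive1n0 fE expr0 mul1r.
have [g' [hg' dg]] := half_form_derive hg.
pose G t := cos ((t - x0) / 2) * (k.+1%:R / 2 * g t + 0 * g t)
          + sin ((t - x0) / 2) * g' t.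
have hG : half_form N.+1 G by apply: half_formS => //; exact: half_form_lin.
have dfE t : f^`()%classic t = sin ((t - x0) / 2) ^+ k * G t.
  have -> : f = ((fun t => sin ((t - x0) / 2)) ^+ k.+1) * g.
    by apply/funext => u; rewrite fE /= !fctE.
  have ds := is_derive_half_sin x0 t.
  rewrite derive1E.
  have dX := is_deriveX k.+1 ds.
  have dM := is_deriveM dX (dg t).
  rewrite derive_val.
  by rewrite /G /GRing.scale /= ?fctE /= exprS; field.
rewrite derive1Sn => /(IH _ _ _ hG dfE).
rewrite /G subrr mul0r cos0 sin0 !mul0r !addr0 mul1r => /eqP.
by rewrite mulf_eq0 gt_eqF ?divr_gt0 ?ltr0n //= => /eqP.
Qed.

Lemma half_form_mul_sinX (R : realType) (k N : nat) (x0 : R) (g : R -> R) :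
  half_form N g -> half_form (k + N) (fun t => sin ((t - x0) / 2) ^+ k * g t).
Proof.
move=> hg; elim: k => [|k /(half_form_mul_sin x0)].
  by apply: half_form_eq hg => t; rewrite expr0 mul1r.
by apply: half_form_eq => t; rewrite exprS mulrA.
Qed.

Lemma half_form_mul_prod (R : realType) (I : Type) (s : seq I) (al : I -> nat)
    (z : I -> R) (N : nat) (g : R -> R) :
  half_form N g -> exists M, half_form M
    (fun t => (\prod_(j <- s) sin ((t - z j) / 2) ^+ al j) * g t).
Proof.
move=> hg; elim: s => [|j s [M hM]].
  by exists N; apply: half_form_eq hg => t; rewrite big_nil mul1r.
exists (al j + M)%N; apply: half_form_eq (half_form_mul_sinX (al j) (z j) hM).
by move=> t; rewrite big_cons mulrA.
Qed.

(** The roots are divided out one after the other.  While dividing by the factor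
    of [z i], the product P of the factors already extracted does not vanish at
    [z i], so the vanishing of the derivatives of f passes to the cofactor. *)
Lemma half_form_factor (R : realType) (I : eqType) (s : seq I) (al : I -> nat)
    (z : I -> R) (N : nat) (f : R -> R) :
  uniq s ->
  (forall i j, i \in s -> j \in s -> i != j -> sin ((z i - z j) / 2) != 0) ->
  (forall i k, i \in s -> (k < al i)%N -> f^`(k)%classic (z i) = 0) ->
  half_form (\sum_(j <- s) al j + N) f ->
  exists g, half_form N g /\
    forall t, f t = (\prod_(j <- s) sin ((t - z j) / 2) ^+ al j) * g t.
Proof.
elim: s N => [|i s IH] N.
  rewrite big_nil => _ _ _ hf; exists f; split=> // t.
  by rewrite big_nil mul1r.
rewrite [uniq _]/= => /andP[i_s s_uniq] z_sep f_van.
rewrite big_cons addnAC addnC => hf.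
have [|j k js|g [hg fE]] := IH _ s_uniq _ _ hf.
- by move=> j k js ks; apply: z_sep; rewrite inE ?js ?ks orbT.
- by apply: f_van; rewrite inE js orbT.
pose P t := \prod_(j <- s) sin ((t - z j) / 2) ^+ al j.
have P_neq0 : P (z i) != 0.
  rewrite prodf_seq_neq0; apply/allP => j js /=.
  rewrite expf_neq0 // z_sep ?inE ?eqxx ?js ?orbT //.
  by apply: contraNneq i_s => ->.
suff /(_ _ (leqnn _))[G [hG fE2]] : forall k, (k <= al i)%N ->
    exists G, half_form (al i - k + N) G /\
      forall t, f t = sin ((t - z i) / 2) ^+ k * (P t * G t).
  exists G; split; first by rewrite subnn add0n in hG.
  by move=> t; rewrite fE2 big_cons mulrA.
elim=> [_|k IHk k_lt].
  by exists g; split; [rewrite subn0 | move=> t; rewrite expr0 mul1r fE].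
have [G [hG fE2]] := IHk (ltnW k_lt).
have [M hM] := half_form_mul_prod s al z hG.
have /eqP := cofactor_vanishes hM fE2 (f_van i k (mem_head _ _) k_lt).
rewrite mulf_eq0 (negPf P_neq0) /= => /eqP G0.
rewrite -subnSK // addSn in hG.
have [H [hH GE]] := half_form_div hG G0.
by exists H; split=> // t; rewrite fE2 GE exprSr; ring.
Qed.

(** The multiplicities exhaust the degree, so the last cofactor is a form of
    degree 0, that is, a constant. *)
Lemma trig_poly_factor (R : realType) (n m : nat) (a b : nat -> R)
    (x : 'I_m -> R) (alpha : 'I_m -> nat) :
  (forall i j, i != j -> sin ((x i - x j) / 2) != 0) ->
  (forall i, root_of_mult (trig_poly n a b) (x i) (alpha i)) ->
  (\sum_(i < m) alpha i = 2 * n)%N ->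
  exists C, forall t,
    trig_poly n a b t = C * \prod_(j < m) sin ((t - x j) / 2) ^+ alpha j.
Proof.
move=> x_sep x_mult alpha_sum.
have [||||g [[C gE] TE]] := @half_form_factor R _ (index_enum 'I_m) alpha x 0
  (trig_poly n a b).
- exact: index_enum_uniq.
- by move=> i j _ _; exact: x_sep.
- by move=> i k _; have [+ _] := x_mult i; exact.
- by rewrite addn0 alpha_sum mul2n; exact: half_form_trig_poly.
by exists C => t; rewrite TE gE mulrC.
Qed.

(** The derivative is in the form f times its logarithmic derivative, because
    both T and Q enter the iteration through that quotient only. *)
Lemma is_derive_sin_prod (R : realType) (I : Type) (s : seq I) (P : pred I)
    (al : I -> nat) (z : I -> R) (t : R) :
  (forall j, P j -> sin ((t - z j) / 2) != 0) ->
  is_derive t 1 (fun t : R => \prod_(j <- s | P j) sin ((t - z j) / 2) ^+ al j)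
    ((\prod_(j <- s | P j) sin ((t - z j) / 2) ^+ al j) *
     ((\sum_(j <- s | P j)
        (al j)%:R * (cos ((t - z j) / 2) / sin ((t - z j) / 2))) / 2)).
Proof.
move=> z_neq; elim: s => [|j s IH].
  under eq_fun do rewrite big_nil.
  by rewrite !big_nil mul0r mulr0; exact: is_derive_cst.
under eq_fun do rewrite big_cons.
rewrite !big_cons; case: ifP => // /z_neq sj_neq0.
have ds := is_derive_half_sin (z j) t.
have dX := is_deriveX (al j) ds.
have dM := is_deriveM dX IH.
set F := (X in is_derive t 1 X _) in dM.
have -> : (fun u : R => sin ((u - z j) / 2) ^+ al j *
    \prod_(k <- s | P k) sin ((u - z k) / 2) ^+ al k) = F.
  by apply/funext => u; rewrite /F !fctE.
apply: is_derive_eq dM _.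
rewrite /GRing.scale /= ?fctE /=.
case: (al j) => [|k]; first by rewrite !expr0 mulr0n; ring.
by rewrite exprS /=; field.
Qed.

(** * Elementary trigonometric estimates *)

Lemma norm_le_of_derive (R : realType) (f df : R -> R) (x M : R) :
  f 0 = 0 -> (forall y : R, is_derive y 1 f (df y)) ->
  (forall y, `|y| <= `|x| -> `|df y| <= M) -> `|f x| <= M * `|x|.
Proof.
move=> f0 fdf df_le.
have fc (u v : R) : {within `[u, v], continuous f}.
  apply: derivable_within_continuous => y _.
  by have [] := fdf y.
have [x0|x0] := leP 0 x.
  have [y + fE] := MVT_segment x0 (fun y _ => fdf y) (fc _ _).
  rewrite in_itv /= => /andP[y0 yx].
  rewrite f0 !subr0 in fE; rewrite fE normrM ler_wpM2r // df_le //.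
  by rewrite !ger0_norm.
have [y + fE] := MVT_segment (ltW x0) (fun y _ => fdf y) (fc _ _).
rewrite in_itv /= => /andP[xy y0].
rewrite f0 !sub0r in fE; rewrite -normrN fE normrM normrN ler_wpM2r // df_le //.
by rewrite !ler0_norm ?lerN2 // ltW.
Qed.

Lemma norm_sin_le (R : realType) (x : R) : `|sin x| <= `|x|.
Proof.
rewrite -[leRHS]mul1r; apply: (@norm_le_of_derive _ _ cos) => [|y _].
- exact: sin0.
- exact: cos_max.
Qed.

Lemma cos_ge_quadratic (R : realType) (x : R) : 1 - x ^+ 2 / 2 <= cos x.
Proof.
have := norm_sin_le (x / 2).
rewrite -(@ler_pXn2r _ 2) ?nnegrE // !real_normK ?num_real // => h.
rewrite {2}[x]splitr cosD -!expr2 cos2sin2.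
by rewrite expr_div_n in h; lra.
Qed.

(** The derivative of [x * cos x - sin x] is [- x * sin x], of second order. *)
Lemma norm_mul_cos_sub_sin (R : realType) (x : R) :
  `|x * cos x - sin x| <= `|x| ^+ 3.
Proof.
rewrite exprSr.
apply: (@norm_le_of_derive _ (fun y => y * cos y - sin y) (fun y => - (y * sin y)))
  => [|y|y yx].
- by rewrite mul0r sin0 subr0.
- apply: is_derive_eq (is_deriveB (is_deriveM (is_derive_id y 1)
    (is_derive_cos y)) (is_derive_sin y)) _.
  by rewrite /GRing.scale /=; ring.
- rewrite normrN normrM expr2; apply: ler_pM => //.
  exact: le_trans (norm_sin_le y) yx.
Qed.

(** The sine increases up to [pi / 2] and is symmetric about it, so on an interval
    inside [0, pi] its minimum is attained at an end. *)
Lemma sin_ge_min (R : realType) (r1 r2 s : R) :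
  0 <= r1 -> 0 <= r2 -> r1 <= s -> s <= pi - r2 ->
  Num.min (sin r1) (sin r2) <= sin s.
Proof.
have mono (u v : R) : 0 <= u -> u <= v -> v <= pi / 2 -> sin u <= sin v.
  move=> u0 uv vpi; have p0 : 0 <= (pi : R) / 2 by rewrite divr_ge0 ?pi_ge0.
  move: uv; rewrite le_eqVlt => /predU1P[-> //|uv].
  by rewrite ltW // ltr_sin // in_itv /=; apply/andP; split; lra.
move=> r10 r20 r1s sr2; rewrite ge_min.
have [spi|spi] := leP s (pi / 2); first by rewrite mono.
apply/orP; right.
have -> : sin s = sin (pi - s) by rewrite sinB sinpi cospi; ring.
by apply: mono => //; lra.
Qed.

Lemma norm_sin_half_ge (R : realType) (r1 r2 z : R) :
  0 <= r1 -> 0 <= r2 -> 2 * r1 <= `|z| -> `|z| <= 2 * pi - 2 * r2 ->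
  Num.min (sin r1) (sin r2) <= `|sin (z / 2)|.
Proof.
move=> r10 r20 r1z zr2.
have -> : `|sin (z / 2)| = `|sin (`|z| / 2)|.
  have [z0|z0] := leP 0 z; first by rewrite (ger0_norm z0).
  by rewrite (ltr0_norm z0) mulNr sinN normrN.
by apply: le_trans (ler_norm _); apply: sin_ge_min; lra.
Qed.

(** * The error of one step *)

(** The inequality on [c] reads [c ^+ 2 * X < L ^+ 2].  Here [e ^+ 3 * X] bounds
    the numerator, and L bounds the denominator [al * C + B * S] from below,
    provided that L is positive.  The inequality only controls the square of L,
    but it does exclude [L <= 0]: then [- L] would be at most
    [c / 2 * (be / A)], whose square is one of the terms of [c ^+ 2 * X]. *)
Lemma cubic_error_bound (R : realFieldType) (al be A c e eps S C B dB : R) :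
  0 < al -> 0 <= be -> 0 < A -> 0 < c -> c <= 2 -> e <= c -> `|eps| <= e ->
  `|S| <= `|eps| / 2 -> `|C * eps - 2 * S| <= `|eps| ^+ 3 / 4 ->
  1 - eps ^+ 2 / 8 <= C -> `|C| <= 1 ->
  `|B| <= be / A -> `|dB| <= be * (e / (2 * A ^+ 2)) ->
  c ^+ 2 * (al ^+ 2 + 1 / (4 * A ^+ 2) * be ^+ 2
            + c / 4 * (al / A) * be
            + al * (1 / (2 * A ^+ 2) * be + 1 / 6 * (c / A) * be))
  < (al * (1 - c ^+ 2 / 8) - c / 2 * (1 / A) * be) ^+ 2 ->
  0 < al * C + B * S /\
  `|(al ^+ 2 * C * (C * eps - 2 * S) + 2 * al * B * S * (C * eps - 2 * S)
     + 2 * al * dB * S ^+ 2 + eps * B ^+ 2 * S ^+ 2) / (al * C + B * S) ^+ 2|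
  <= e ^+ 3 / c ^+ 2.
Proof.
move=> al0 be0 A0 c0 c2 ec epse S_le CS_le C_ge C_le B_le dB_le small.
have e0 : 0 <= e by apply: le_trans epse.
pose p := be / A; pose r := be / A ^+ 2.
have p0 : 0 <= p by rewrite divr_ge0 // ltW.
have r0 : 0 <= r by rewrite divr_ge0 // exprn_ge0 // ltW.
pose X := al ^+ 2 + p ^+ 2 / 4 + c / 4 * al * p + al * (r / 2 + c * p / 6).
pose L := al * (1 - c ^+ 2 / 8) - c / 2 * p.
have {}small : c ^+ 2 * X < L ^+ 2.
  have -> : X = al ^+ 2 + 1 / (4 * A ^+ 2) * be ^+ 2 + c / 4 * (al / A) * be
      + al * (1 / (2 * A ^+ 2) * be + 1 / 6 * (c / A) * be).
    by rewrite /X /p /r; field; rewrite gt_eqF.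
  by have -> : L = al * (1 - c ^+ 2 / 8) - c / 2 * (1 / A) * be
    by rewrite /L /p; field; rewrite gt_eqF.
rewrite -/p in B_le.
have {}dB_le : `|dB| <= r * e / 2.
  by apply: le_trans dB_le _; rewrite /r le_eqVlt; apply/orP; left;
     apply/eqP; field; rewrite gt_eqF.
have alp : 0 <= al * p by rewrite mulr_ge0 // ltW.
have alr : 0 <= al * r by rewrite mulr_ge0 // ltW.
have calp : 0 <= c * (al * p) by rewrite mulr_ge0 // ltW.
have c2le : c ^+ 2 / 8 <= 1 by nra.
have L0 : 0 < L.
  rewrite ltNge; apply/negP => L_le0.
  have w0 : 0 <= al * (1 - c ^+ 2 / 8) by rewrite mulr_ge0 ?subr_ge0 // ltW.
  have L_ge : - (c / 2 * p) <= L by rewrite /L; lra.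
  have : L ^+ 2 <= (c / 2 * p) ^+ 2.
    by rewrite -sqrrN ler_pXn2r ?nnegrE //; nra.
  apply/negP; rewrite -ltNge; apply: le_lt_trans small.
  have -> : (c / 2 * p) ^+ 2 = c ^+ 2 * (p ^+ 2 / 4) by field.
  by rewrite ler_wpM2l ?sqr_ge0 // /X; have := sqr_ge0 al; lra.
have epsc : `|eps| <= c := le_trans epse ec.
have BS_le : `|B * S| <= c / 2 * p.
  rewrite normrM mulrC; apply: ler_pM => //.
  by apply: le_trans S_le _; rewrite ler_pM2r.
have eps2 : eps ^+ 2 <= c ^+ 2.
  by rewrite -[eps ^+ 2]real_normK ?num_real // ler_pXn2r ?nnegrE // ltW.
have D_ge : L <= al * C + B * S.
  have h1 : al * (1 - c ^+ 2 / 8) <= al * C by rewrite ler_pM2l //; lra.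
  have := ler_norm (- (B * S)); rewrite normrN /L; lra.
have D0 := lt_le_trans L0 D_ge.
split=> //.
have S_le' : `|S| <= e / 2 by apply: le_trans S_le _; rewrite ler_pM2r.
have eps3 : `|C * eps - 2 * S| <= e ^+ 3 / 4.
  by apply: le_trans CS_le _; rewrite ler_pM2r // ler_pXn2r ?nnegrE.
have S2 : S ^+ 2 <= e ^+ 2 / 4.
  have -> : e ^+ 2 / 4 = (e / 2) ^+ 2 by field.
  by rewrite -[S ^+ 2]real_normK ?num_real // ler_pXn2r ?nnegrE // divr_ge0.
have e3 : 0 <= e ^+ 3 by exact: exprn_ge0.
have num_le : `|al ^+ 2 * C * (C * eps - 2 * S) + 2 * al * B * S * (C * eps - 2 * S)
     + 2 * al * dB * S ^+ 2 + eps * B ^+ 2 * S ^+ 2| <= e ^+ 3 * X.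
  have t1 : `|al ^+ 2 * C * (C * eps - 2 * S)| <= al ^+ 2 * 1 * (e ^+ 3 / 4).
    rewrite normrM [`|al ^+ 2 * C|]normrM normrX (gtr0_norm al0); apply: ler_pM => //.
      by rewrite mulr_ge0 // exprn_ge0 // ltW.
    by rewrite ler_pM2l // exprn_gt0.
  have t2 : `|2 * al * B * S * (C * eps - 2 * S)|
      <= 2 * al * p * (c / 2) * (e ^+ 3 / 4).
    rewrite !normrM (gtr0_norm al0) normr_nat; apply: ler_pM => //.
      by rewrite !mulr_ge0 // ltW.
    apply: ler_pM => //; first by rewrite !mulr_ge0 // ltW.
      by rewrite ler_pM2l // mulr_gt0.
    by apply: le_trans S_le _; rewrite ler_pM2r.
  have t3 : `|2 * al * dB * S ^+ 2| <= 2 * al * (r * e / 2) * (e ^+ 2 / 4).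
    rewrite normrM [`|2 * al * dB|]normrM [`|2 * al|]normrM.
    rewrite (gtr0_norm al0) normr_nat (ger0_norm (sqr_ge0 S)).
    apply: ler_pM => //; rewrite ?sqr_ge0 //; first by rewrite !mulr_ge0 // ltW.
    by rewrite ler_pM2l // mulr_gt0.
  have t4 : `|eps * B ^+ 2 * S ^+ 2| <= e * p ^+ 2 * (e ^+ 2 / 4).
    rewrite normrM [`|eps * B ^+ 2|]normrM (ger0_norm (sqr_ge0 S)) normrX.
    apply: ler_pM => //; rewrite ?sqr_ge0 //.
    apply: ler_pM => //; rewrite ?sqr_ge0 //.
    by rewrite ler_pXn2r ?nnegrE.
  have tri := le_trans (ler_normD _ _) (lerD (le_trans (ler_normD _ _)
    (lerD (le_trans (ler_normD _ _) (lerD t1 t2)) t3)) t4).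
  apply: le_trans tri _.
  have -> : al ^+ 2 * 1 * (e ^+ 3 / 4) + 2 * al * p * (c / 2) * (e ^+ 3 / 4)
      + 2 * al * (r * e / 2) * (e ^+ 2 / 4) + e * p ^+ 2 * (e ^+ 2 / 4)
    = e ^+ 3 * (al ^+ 2 / 4 + c * (al * p) / 4 + al * r / 4 + p ^+ 2 / 4) by field.
  by rewrite ler_wpM2l // /X; have := sqr_ge0 al; lra.
rewrite normrM normfV (ger0_norm (sqr_ge0 _)).
rewrite ler_pdivrMr ?exprn_gt0 // [leRHS]mulrAC ler_pdivlMr ?exprn_gt0 //.
apply: le_trans (ler_wpM2r (sqr_ge0 c) num_le) _.
rewrite -mulrA ler_wpM2l // mulrC; apply: le_trans (ltW small) _.
by rewrite ler_pXn2r ?nnegrE // ltW.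
Qed.

(** Uses [cot a - cot b = sin (b - a) / (sin a * sin b)]. *)
Lemma norm_cot_sub (R : realType) (A e t u v : R) :
  0 < A -> A <= `|sin ((t - u) / 2)| -> A <= `|sin ((t - v) / 2)| ->
  `|v - u| <= e ->
  `|cos ((t - u) / 2) / sin ((t - u) / 2) - cos ((t - v) / 2) / sin ((t - v) / 2)|
    <= e / (2 * A ^+ 2).
Proof.
move=> A0 Au Av uv.
have su : sin ((t - u) / 2) != 0 by rewrite -normr_gt0 (lt_le_trans A0).
have sv : sin ((t - v) / 2) != 0 by rewrite -normr_gt0 (lt_le_trans A0).
have -> : cos ((t - u) / 2) / sin ((t - u) / 2) -
    cos ((t - v) / 2) / sin ((t - v) / 2)
  = sin ((u - v) / 2) / (sin ((t - u) / 2) * sin ((t - v) / 2)).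
  have -> : (u - v) / 2 = (t - v) / 2 - (t - u) / 2 by field.
  rewrite sinB; field; exact/andP.
have -> : e / (2 * A ^+ 2) = e / 2 * (A * A)^-1.
  by field; rewrite gt_eqF.
rewrite normrM normfV normrM; apply: ler_pM => //.
  apply: le_trans (norm_sin_le _) _.
  by rewrite normrM normfV normr_nat distrC ler_pM2r.
rewrite lef_pV2 ?posrE ?mulr_gt0 ?normr_gt0 //.
by apply: ler_pM => //; exact: ltW.
Qed.

(** If [y i] is already the root, then T vanishes there, the quotient
    [T / T^`()] is 0 whatever the derivative is, and the step stays at the root.
    Otherwise all sines involved are nonzero and [cubic_error_bound] applies. *)
Lemma iter_step_error (R : realType) (m : nat) (alpha : 'I_m -> nat)
    (T : R -> R) (x y : 'I_m -> R) (i : 'I_m) (K A c e : R) :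
  (forall t, T t = K * \prod_(j < m) sin ((t - x j) / 2) ^+ alpha j) ->
  K != 0 -> (0 < alpha i)%N -> 0 < A -> 0 < c -> c <= 2 -> e <= c ->
  (forall j, `|y j - x j| <= e) ->
  (forall j, j != i -> A <= `|sin ((y i - x j) / 2)|) ->
  (forall j, j != i -> A <= `|sin ((y i - y j) / 2)|) ->
  (let al : R := (alpha i)%:R in
   let be : R := \sum_(j < m | j != i) (alpha j)%:R in
   c ^+ 2 * (al ^+ 2 + 1 / (4 * A ^+ 2) * be ^+ 2
             + c / 4 * (al / A) * be
             + al * (1 / (2 * A ^+ 2) * be + 1 / 6 * (c / A) * be))
   < (al * (1 - c ^+ 2 / 8) - c / 2 * (1 / A) * be) ^+ 2) ->
  `|iter_step alpha T y i - x i| <= e ^+ 3 / c ^+ 2.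
Proof.
move=> TE K0 alpha0 A0 c0 c2 ec y_near Ax Ay /= small.
have e0 : 0 <= e := le_trans (normr_ge0 _) (y_near i).
set al := (alpha i)%:R in small *; set be := \sum_(j < m | _) _ in small *.
have al0 : 0 < al by rewrite ltr0n.
have be0 : 0 <= be by apply: sumr_ge0.
have sx_neq0 j : j != i -> sin ((y i - x j) / 2) != 0.
  by move=> /Ax; rewrite -normr_gt0; exact: lt_le_trans.
have sy_neq0 j : j != i -> sin ((y i - y j) / 2) != 0.
  by move=> /Ay; rewrite -normr_gt0; exact: lt_le_trans.
pose eps := y i - x i.
have [eps0|eps_neq0] := eqVneq eps 0.
  have T0 : T (y i) = 0.
    rewrite TE (bigD1 i) //= -/eps eps0 mul0r sin0 expr0n.
    by rewrite gtn_eqF // !(mul0r, mulr0).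
  rewrite /iter_step T0 mul0r mulr0 mul0r subr0 -/eps eps0 normr0.
  by rewrite divr_ge0 ?exprn_ge0 // ltW.
pose S := sin (eps / 2); pose C := cos (eps / 2).
(* Here [c <= 2 <= pi] keeps [eps / 2] away from the other zeros of sin. *)
have S_neq0 : S != 0.
  have epsc : `|eps| <= 2 by apply: le_trans (y_near i) (le_trans ec c2).
  have /andP[h1 h2] : - 2 <= eps <= 2 by rewrite -ler_norml.
  have pi2 := pi_ge2 R.
  rewrite /S; have [epsP|epsN] := ltP 0 eps.
    by rewrite gt_eqF // sin_gt0_pi //; apply/andP; split; lra.
  have {epsN}epsN : eps < 0 by rewrite lt_neqAle eps_neq0.
  have : 0 < sin (- (eps / 2)) by rewrite sin_gt0_pi //; apply/andP; split; lra.
  by rewrite sinN oppr_gt0 => /lt_eqF ->.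
pose B := \sum_(j < m | j != i)
  (alpha j)%:R * (cos ((y i - x j) / 2) / sin ((y i - x j) / 2)).
pose Bt := \sum_(j < m | j != i)
  (alpha j)%:R * (cos ((y i - y j) / 2) / sin ((y i - y j) / 2)).
have QE : (Qfun alpha y i)^`()%classic (y i) / Qfun alpha y i (y i) = Bt / 2.
  have dQ := @is_derive_sin_prod R _ (index_enum 'I_m) [pred j | j != i]
    alpha y (y i) sy_neq0.
  rewrite derive1E (derive_val (df := Qfun alpha y i (y i) * (Bt / 2))).
  rewrite mulrAC divff ?mul1r //.
  by apply/prodf_neq0 => j ji; rewrite expf_neq0 // sy_neq0.
have sx_all j : sin ((y i - x j) / 2) != 0.
  by have [->|] := eqVneq j i; [exact: S_neq0 | exact: sx_neq0].
have T_neq0 : T (y i) != 0.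
  by rewrite TE mulf_neq0 //; apply/prodf_neq0 => j _; rewrite expf_neq0.
have T'E : T^`()%classic (y i) = T (y i) * ((al * (C / S) + B) / 2).
  pose F t := \prod_(j < m) sin ((t - x j) / 2) ^+ alpha j.
  have dF := is_derive_sin_prod (index_enum 'I_m) alpha
    (fun j (_ : xpredT j) => sx_all j).
  have dKF := is_deriveZ K dF.
  have -> : T = K \*: F by apply/funext => t; rewrite TE.
  rewrite derive1E (derive_val (is_derive := dKF)) scalerAl.
  by congr (_ * (_ / 2)); rewrite (bigD1 i).
pose D := al * C + B * S.
have [D_gt0 bound] : 0 < D /\
  `|(al ^+ 2 * C * (C * eps - 2 * S) + 2 * al * B * S * (C * eps - 2 * S)
     + 2 * al * (B - Bt) * S ^+ 2 + eps * B ^+ 2 * S ^+ 2) / D ^+ 2|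
  <= e ^+ 3 / c ^+ 2.
  apply: (cubic_error_bound (be := be) (A := A)) => //.
  - exact: y_near.
  - apply: le_trans (norm_sin_le _) _.
    by rewrite normrM normfV normr_nat.
  - have := norm_mul_cos_sub_sin (eps / 2).
    rewrite -/C -/S normrM normfV normr_nat expr_div_n => h.
    have -> : C * eps - 2 * S = 2 * (eps / 2 * C - S) by field.
    by rewrite normrM normr_nat; lra.
  - by have := cos_ge_quadratic (eps / 2); rewrite -/C expr_div_n; lra.
  - exact: cos_max.
  - rewrite /B /be mulr_suml; apply: le_trans (ler_norm_sum _ _ _) _.
    apply: ler_sum => j ji; rewrite normrM normr_nat ler_wpM2l // normrM normfV.
    rewrite -[leRHS]mul1r; apply: ler_pM => //; first exact: cos_max.
    by rewrite lef_pV2 ?posrE ?normr_gt0 ?sx_neq0 // Ax.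
  - rewrite /B /Bt -sumrB /be mulr_suml; apply: le_trans (ler_norm_sum _ _ _) _.
    apply: ler_sum => j ji; rewrite -mulrBr normrM normr_nat ler_wpM2l //.
    exact: norm_cot_sub A0 (Ax _ ji) (Ay _ ji) (y_near j).
have uE : T (y i) / T^`()%classic (y i) = 2 * S / D.
  rewrite T'E /D; have := lt0r_neq0 D_gt0; rewrite /D => D_neq0.
  field.
  by rewrite T_neq0 S_neq0 D_neq0.
rewrite /iter_step /= QE uE -/al.
set E := (X in `|X| <= _).
suff -> : E = (al ^+ 2 * C * (C * eps - 2 * S) + 2 * al * B * S * (C * eps - 2 * S)
     + 2 * al * (B - Bt) * S ^+ 2 + eps * B ^+ 2 * S ^+ 2) / D ^+ 2 by [].
have -> : E = eps - al * (2 * S / D) * (1 + 2 * S / D * (Bt / 2)).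
  by rewrite /E /eps; ring.
have := lt0r_neq0 D_gt0; rewrite /D => D_neq0; field.
by [].
Qed.

(** * Cubic convergence *)

Theorem theorem2 (R : realType) (n m : nat) (a b : nat -> R)
    (x : 'I_m -> R) (alpha : 'I_m -> nat) (d D c q xi A : R)
    (xs : nat -> 'I_m -> R)
    (h_deg : 0 < a n ^+ 2 + b n ^+ 2)
    (h_inj : injective x)
    (h_roots : forall t : R,
       (- pi <= t < pi /\ trig_poly n a b t = 0) <-> exists i, t = x i)
    (h_alpha : forall i, (0 < alpha i)%N)
    (h_mult : forall i, root_of_mult (trig_poly n a b) (x i) (alpha i))
    (h_sum : (\sum_(i < m) alpha i = 2 * n)%N)
    (h_d : is_min (root_dists x) d)
    (h_D : is_max (root_dists x) D)
    (h_c : 0 < c) (h_q : 0 < q) (h_xi : 0 < xi)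
    (h_q1 : q < 1) (h_cxi : 2 * c < xi) (h_dc : 0 < d - 2 * c)
    (h_Dxi : D < 2 * pi - 2 * xi)
    (h_A : A = Num.min `|sin (xi / 2)| `|sin (d / 2 - c)|)
    (h_small : forall i : 'I_m,
       let al : R := (alpha i)%:R in
       let be : R := 2 * n%:R - al in
       c ^+ 2 * (al ^+ 2 + 1 / (4 * A ^+ 2) * be ^+ 2
                 + c / 4 * (al / A) * be
                 + al * (1 / (2 * A ^+ 2) * be + 1 / 6 * (c / A) * be))
       < (al * (1 - c ^+ 2 / 8) - c / 2 * (1 / A) * be) ^+ 2)
    (h_init : forall i, `|xs 0%N i - x i| <= c * q)
    (h_iter : forall k i,
       xs k.+1 i = iter_step alpha (trig_poly n a b) (xs k) i) :
  forall (k : nat) (i : 'I_m), `|xs k i - x i| <= c * q ^+ (3 ^ k)%N.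
Proof.
have [[i0 [j0 [ij0 dE]]] d_le] := h_d.
have [_ D_ge] := h_D.
have pi0 := pi_gt0 R; have pi4 : (pi : R) < 4.
  by have := pihalf_lt2 R; rewrite ltr_pdivrMr //; lra.
have dist_ge i j : i != j -> d <= `|x i - x j|.
  by move=> ij; apply: d_le; exists i, j.
have dist_le i j : i != j -> `|x i - x j| <= D.
  by move=> ij; apply: D_ge; exists i, j.
have dD : d <= D by rewrite dE dist_le.
(* [2 * c < d <= D < 2 * pi - 2 * xi] and [2 * c < xi] put [d / 2 - c] and
   [xi / 2] in the open interval from 0 to pi, so both sines are positive. *)
have AE : A = Num.min (sin (d / 2 - c)) (sin (xi / 2)).
  by rewrite h_A minC !ger0_norm //; apply: sin_ge0_pi; apply/andP; split; lra.
have A0 : 0 < A.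
  by rewrite AE lt_min !sin_gt0_pi //; apply/andP; split; lra.
(* [x i - x j] is between d and [2 * pi - 2 * xi] in absolute value.  A change of
   at most [2 * c < xi] leaves [`|z| / 2] between [d / 2 - c] and
   [pi - xi / 2]. *)
have sin_far i j (z : R) : i != j -> `|z - (x i - x j)| <= 2 * c ->
    A <= `|sin (z / 2)|.
  move=> ij z_near; rewrite AE.
  have h1 := dist_ge _ _ ij; have h2 := dist_le _ _ ij.
  have h3 := ler_distD z (x i - x j) 0; have h4 := ler_distD (x i - x j) z 0.
  rewrite !subr0 in h3 h4; rewrite distrC in h3.
  by apply: norm_sin_half_ge; lra.
have [K TE] : exists K, forall t, trig_poly n a b t =
    K * \prod_(j < m) sin ((t - x j) / 2) ^+ alpha j.
  apply: trig_poly_factor => // i j ij.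
  rewrite -normr_gt0 (lt_le_trans A0) // (sin_far _ _ _ ij) //.
  by rewrite subrr normr0; lra.
(* Otherwise T would be identically 0, and no root would have a multiplicity. *)
have K0 : K != 0.
  apply/eqP => K0; have [_] := h_mult i0; apply.
  have -> : trig_poly n a b = fun=> 0.
    by apply/funext => t; rewrite TE K0 mul0r.
  elim: (alpha i0) => [//|k IH]; rewrite derive1Sn.
  suff -> : (cst (0 : R))^`()%classic = cst 0 by [].
  by apply/funext => t; rewrite derive1_cst.
have beE i : \sum_(j < m | j != i) (alpha j)%:R = 2 * n%:R - (alpha i)%:R :> R.
  rewrite -natrM -h_sum natr_sum [in RHS](bigD1 i) //=; ring.
elim=> [|k IH] i; first by rewrite expn0 expr1.
set e := c * q ^+ (3 ^ k).
have q_le1 : q ^+ (3 ^ k) <= 1 by rewrite exprn_ile1 ?ltW.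
have ec : e <= c by rewrite -[leRHS]mulr1 ler_pM2l.
have -> : c * q ^+ (3 ^ k.+1) = e ^+ 3 / c ^+ 2.
  by rewrite /e expnSr exprM; field; rewrite gt_eqF.
rewrite h_iter; apply: (iter_step_error (A := A) TE K0) => //.
- lra.
- move=> j ji; apply: (sin_far i j); first by rewrite eq_sym.
  have -> : xs k i - x j - (x i - x j) = xs k i - x i by ring.
  have := IH i; rewrite -/e; lra.
- move=> j ji; apply: (sin_far i j); first by rewrite eq_sym.
  have -> : xs k i - xs k j - (x i - x j) = (xs k i - x i) - (xs k j - x j) by ring.
  have := IH i; have := IH j; have := ler_normB (xs k i - x i) (xs k j - x j).
  rewrite -/e; lra.
- by rewrite /= beE; exact: h_small.
Qed.
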